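(* Let $C$ be a left cancellative category. Then $C'=\mathbf{L}(\mathbf{G}(C))$ is a left cancellative category. Define $\iota:C\to C'$ by $\iota(a)=([\mathbf{r}(a),\mathbf{r}(a)],[a,\mathbf{d}(a)])$. Then $\iota$ is an injective functor which embeds $C$ in $C'$ as a full, isomorphism-dense subcategory. In particular, $C$ and $\mathbf{L}(\mathbf{G}(C))$ are equivalent categories.
   Context: A category is regarded as a (small) set of arrows with a partial product; $C_o$ is its set of identities, $\mathbf{d}(x)$ and $\mathbf{r}(x)$ are the domain and range identities of $x$, and $xy$ is defined (written $\exists xy$) iff $\mathbf{d}(x)=\mathbf{r}(y)$. A category is left cancellative if $xy=xz$ implies $y=z$. A subcategory $C$ of $D$ is full if $x\in D$ and $\mathbf{d}(x),\mathbf{r}(x)\in C$ imply $x\in C$; it is isomorphism-dense if for each $e\in D_o$ there are $f\in C_o$ and an isomorphism in $D$ from $e$ to $f$. An ordered groupoid is a groupoid $G$ with a partial order $\leq$ on the set $G$ such that: (i) $x\leq y$ implies $x^{-1}\leq y^{-1}$; (ii) if $x\leq y$, $u\leq v$, $\exists xu$ and $\exists yv$ then $xu\leq yv$; (iii) if $e$ is an identity with $e\leq\mathbf{d}(x)$ then there is a unique element $(x\,|\,e)\leq x$ with $\mathbf{d}(x\,|\,e)=e$; (iv) if $e$ is an identity with $e\leq\mathbf{r}(x)$ then there is a unique element $(e\,|\,x)\leq x$ with $\mathbf{r}(e\,|\,x)=e$. If $e=\mathbf{d}(x)\wedge\mathbf{r}(y)$ exists in $G_o$, the pseudoproduct is $x\otimes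 y=(x\,|\,e)(e\,|\,y)$. The ordered groupoid $\mathbf{G}(C)$ of a left cancellative category $C$: on $U=\{(a,b)\in C\times C:\mathbf{d}(a)=\mathbf{d}(b)\}$ let $(a,b)\sim(a',b')$ iff $(a,b)=(a'u,b'u)$ for some isomorphism $u$ of $C$. $\mathbf{G}(C)$ is the set of classes $[a,b]$, with $\mathbf{d}[a,b]=[b,b]$, $\mathbf{r}[a,b]=[a,a]$, $[a,b]^{-1}=[b,a]$; if $\mathbf{d}[a,b]=\mathbf{r}[c,d]$ then $b=cu$ for an isomorphism $u$ and $[a,b]\cdot[c,d]=[a,du]$; and $[a,b]\leq[c,d]$ iff $(a,b)=(cp,dp)$ for some $p\in C$. For an ordered groupoid $G$, $\mathbf{L}(G)=\{(e,x)\in G_o\times G:\mathbf{r}(x)\leq e\}$, with $\mathbf{d}(e,x)=(\mathbf{d}(x),\mathbf{d}(x))$, $\mathbf{r}(e,x)=(e,e)$, and $(e,x)(f,y)=(e,x\otimes y)$ when $\mathbf{d}(x)=f$ (undefined otherwise). *)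

(* Defs.v *)
From mathcomp Require Import all_boot.
From mathcomp Require Import boolp classical_sets.
From Stdlib Require Relation_Definitions.
From Stdlib Require Import ProofIrrelevance.

Set Implicit Arguments.
Unset Strict Implicit.
Unset Printing Implicit Defensive.

Local Open Scope classical_set_scope.
Local Open Scope quotient_scope.

(* The partial product is given by its graph: [pprod x y z] reads
   "xy is defined and equals z". *)
Record precategory := Precategory {
  arrow :> Type;
  dom : arrow -> arrow;
  ran : arrow -> arrow;
  pprod : arrow -> arrow -> arrow -> Prop
}.

Arguments dom {p} x.
Arguments ran {p} x.
Arguments pprod {p} x y z.

Definition is_identity (C : precategory) (e : C) : Prop :=
  (forall x z : C, pprod e x z -> z = x) /\
  (forall x z : C, pprod x e z -> z = x).

Record is_category (C : precategory) : Prop := IsCategory {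
  pprod_fun : forall x y z z' : C, pprod x y z -> pprod x y z' -> z = z';
  pprod_def : forall x y : C, (exists z, pprod x y z) <-> dom x = ran y;
  dom_id : forall x : C, is_identity (dom x);
  ran_id : forall x : C, is_identity (ran x);
  pprod_dom : forall x : C, pprod x (dom x) x;
  pprod_ran : forall x : C, pprod (ran x) x x;
  dom_pprod : forall x y z : C, pprod x y z -> dom z = dom y;
  ran_pprod : forall x y z : C, pprod x y z -> ran z = ran x;
  pprodA : forall x y z u v w : C,
    pprod x y u -> pprod y z v -> (pprod u z w <-> pprod x v w)
}.

Definition left_cancellative (C : precategory) : Prop :=
  forall x y z w : C, pprod x y w -> pprod x z w -> y = z.

Record lc_category := LCCategory {
  lc_precategory :> precategory;
  lc_is_category : is_category lc_precategory;
  lc_left_cancellative : left_cancellative lc_precategory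
}.

Definition is_iso (C : precategory) (u : C) : Prop :=
  exists v : C, pprod u v (ran u) /\ pprod v u (dom u).

Record is_subcategory (D : precategory) (P : set D) : Prop := IsSubcategory {
  subcat_dom : forall x, P x -> P (dom x);
  subcat_ran : forall x, P x -> P (ran x);
  subcat_pprod : forall x y z, P x -> P y -> pprod x y z -> P z
}.

Definition full (D : precategory) (P : set D) : Prop :=
  forall x : D, P (dom x) -> P (ran x) -> P x.

Definition iso_dense (D : precategory) (P : set D) : Prop :=
  forall e : D, is_identity e ->
    exists f : D, [/\ P f, is_identity f &
      exists u : D, [/\ is_iso u, dom u = e & ran u = f]].

Record is_functor (C D : precategory) (F : C -> D) : Prop := IsFunctor {
  functor_dom : forall x : C, F (dom x) = dom (F x);
  functor_ran : forall x : C, F (ran x) = ran (F x);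
  functor_pprod : forall x y z : C, pprod x y z -> pprod (F x) (F y) (F z)
}.

(* Only the components [t e] at identities [e] are meaningful. *)
Record is_natural_iso (C D : precategory) (F K : C -> D) (t : C -> D) : Prop :=
  IsNaturalIso {
  natural_iso_iso : forall e : C, is_identity e ->
    [/\ is_iso (t e), dom (t e) = F e & ran (t e) = K e];
  natural_iso_square : forall x : C, exists z : D,
    pprod (t (ran x)) (F x) z /\ pprod (K x) (t (dom x)) z
}.

Definition equivalent (C D : precategory) : Prop :=
  exists (F : C -> D) (K : D -> C),
    [/\ is_functor F, is_functor K,
        exists s : C -> C, is_natural_iso (K \o F) idfun s &
        exists t : D -> D, is_natural_iso (F \o K) idfun t].

Section CategoryFacts.
Variables (C : precategory) (hC : is_category C).
Implicit Types a b c e u v w x y z : C.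

Lemma pprod_ex x y : dom x = ran y -> exists z, pprod x y z.
Proof. by move/(pprod_def hC). Qed.

Lemma pprod_eq x y z : pprod x y z -> dom x = ran y.
Proof. by move=> h; apply/(pprod_def hC); exists z. Qed.

Lemma dom_identity e : is_identity e -> dom e = e.
Proof. by case=> h _; rewrite -(h _ _ (pprod_dom hC e)). Qed.

Lemma ran_identity e : is_identity e -> ran e = e.
Proof. by case=> _ h; rewrite -(h _ _ (pprod_ran hC e)). Qed.

Lemma domK x : dom (dom x) = dom x.
Proof. exact: dom_identity (dom_id hC x). Qed.

Lemma ran_dom x : ran (dom x) = dom x.
Proof. exact: ran_identity (dom_id hC x). Qed.

Lemma dom_ran x : dom (ran x) = ran x.
Proof. exact: dom_identity (ran_id hC x). Qed.

Lemma ranK x : ran (ran x) = ran x.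
Proof. exact: ran_identity (ran_id hC x). Qed.

Lemma pprodAl x y z u w : pprod x y u -> pprod u z w ->
  exists2 v, pprod y z v & pprod x v w.
Proof.
move=> xy uz; have [v yz] : exists v, pprod y z v.
  by apply: pprod_ex; rewrite -(dom_pprod hC xy) (pprod_eq uz).
by exists v => //; apply/(pprodA hC w xy yz).
Qed.

Lemma pprodAr x y z v w : pprod y z v -> pprod x v w ->
  exists2 u, pprod x y u & pprod u z w.
Proof.
move=> yz xv; have [u xy] : exists u, pprod x y u.
  by apply: pprod_ex; rewrite -(ran_pprod hC yz) (pprod_eq xv).
by exists u => //; apply/(pprodA hC w xy yz).
Qed.

Lemma iso_identity e : is_identity e -> is_iso e.
Proof.
by move=> he; exists e; have := pprod_dom hC e;
  rewrite dom_identity // ran_identity.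
Qed.

Lemma iso_inverse u : is_iso u ->
  exists2 v, is_iso v & forall a b, pprod a u b -> pprod b v a.
Proof.
case=> v [uv vu].
have rv : ran v = dom u by rewrite (pprod_eq uv).
have dv : dom v = ran u by rewrite (pprod_eq vu).
exists v; first by exists u; rewrite rv dv.
move=> a b au; apply/(pprodA hC a au uv).
by rewrite -(pprod_eq au); apply: pprod_dom.
Qed.

Lemma iso_pprod u v w : is_iso u -> is_iso v -> pprod u v w -> is_iso w.
Proof.
case=> u' [uu' u'u] [v' [vv' v'v]] uv.
have duv := pprod_eq uv.
have [w' v'u'] : exists w', pprod v' u' w'.
  by apply: pprod_ex; rewrite (pprod_eq v'v) -duv (pprod_eq uu').
exists w'; split.
- rewrite (ran_pprod hC uv).
  have h : pprod w v' u.
    by apply/(pprodA hC u uv vv'); rewrite -duv; apply: pprod_dom.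
  by apply/(pprodA hC _ h v'u').
- rewrite (dom_pprod hC uv).
  have h : pprod u' w v.
    by apply/(pprodA hC v u'u uv); rewrite duv; apply: pprod_ran.
  by apply/(pprodA hC _ v'u' h).
Qed.

End CategoryFacts.

Record ordered_groupoid := OrderedGroupoid {
  og_precategory :> precategory;
  og_inv : og_precategory -> og_precategory;
  og_le : og_precategory -> og_precategory -> Prop;
  og_is_category : is_category og_precategory;
  og_pprodV : forall x, pprod x (og_inv x) (ran x);
  og_pprodVl : forall x, pprod (og_inv x) x (dom x);
  og_order : Relation_Definitions.order _ og_le;
  og_leV : forall x y, og_le x y -> og_le (og_inv x) (og_inv y);
  og_leM : forall x y u v s t, og_le x y -> og_le u v ->
    pprod x u s -> pprod y v t -> og_le s t;
  og_restriction : forall x e, is_identity e -> og_le e (dom x) ->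
    exists! x', og_le x' x /\ dom x' = e;
  og_corestriction : forall x e, is_identity e -> og_le e (ran x) ->
    exists! x', og_le x' x /\ ran x' = e
}.

Arguments og_inv {o} x.
Arguments og_le {o} x y.

Definition is_identity_meet (G : ordered_groupoid) (f g e : G) : Prop :=
  [/\ is_identity e, og_le e f, og_le e g &
      forall e' : G, is_identity e' -> og_le e' f -> og_le e' g -> og_le e' e].

(* [pseudoproduct x y z]: the pseudoproduct of x and y is defined and equals z;
   the witnesses x' and y' are (x | e) and (e | y). *)
Definition pseudoproduct (G : ordered_groupoid) (x y z : G) : Prop :=
  exists e x' y' : G,
    [/\ is_identity_meet (dom x) (ran y) e,
        og_le x' x /\ dom x' = e,
        og_le y' y /\ ran y' = e &
        pprod x' y' z].

Section GroupoidOfCategory.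
Variable C : lc_category.

Let hC : is_category C := lc_is_category C.
Let lC : left_cancellative C := @lc_left_cancellative C.

Record span := Span {
  leg1 : C;
  leg2 : C;
  span_dom : dom leg1 = dom leg2
}.

Lemma span_ext (p q : span) : leg1 p = leg1 q -> leg2 p = leg2 q -> p = q.
Proof.
case: p q => [a b h] [a' b' h'] /= ea eb.
by subst a' b'; rewrite (proof_irrelevance _ h h').
Qed.

Definition span_mul (q : span) (r : C) (p : span) : Prop :=
  pprod (leg1 q) r (leg1 p) /\ pprod (leg2 q) r (leg2 p).

Definition span_sim (p q : span) : Prop :=
  exists2 u : C, is_iso u & span_mul q u p.

Lemma span_sim_refl p : span_sim p p.
Proof.
exists (dom (leg1 p)); first exact: iso_identity hC _ (dom_id hC _).
split; first exact: pprod_dom hC _.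
by rewrite span_dom; apply: pprod_dom hC _.
Qed.

Lemma span_sim_sym p q : span_sim p q -> span_sim q p.
Proof.
case=> u /(iso_inverse hC) [v iv hv] [h1 h2].
by exists v => //; split; apply: hv.
Qed.

Lemma span_mul_trans p q r u v w :
  span_mul q u p -> span_mul r v q -> pprod v u w -> span_mul r w p.
Proof.
move=> [p1 p2] [q1 q2] vu; split.
  by apply/(pprodA hC _ q1 vu).
by apply/(pprodA hC _ q2 vu).
Qed.

Lemma span_mul_comp p q r u v :
  span_mul q u p -> span_mul r v q -> exists2 w, pprod v u w & span_mul r w p.
Proof.
move=> hp hq; have [w vu] : exists w, pprod v u w.
  apply: (pprod_ex hC).
  by rewrite -(dom_pprod hC hq.1) (pprod_eq hC hp.1).
by exists w => //; apply: span_mul_trans hp hq vu.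
Qed.

Lemma span_sim_trans p q r : span_sim p q -> span_sim q r -> span_sim p r.
Proof.
move=> [u iu hu] [v iv hv].
have [w vu hw] := span_mul_comp hu hv.
by exists w => //; apply: iso_pprod hC _ _ _ iv iu vu.
Qed.

Definition span_simb : rel {classic span} := fun p q => `[< span_sim p q >].

Lemma span_simb_refl : reflexive span_simb.
Proof. by move=> p; apply/asboolP/span_sim_refl. Qed.

Lemma span_simb_sym : symmetric span_simb.
Proof.
by move=> p q; apply/asboolP/asboolP; apply: span_sim_sym.
Qed.

Lemma span_simb_trans : transitive span_simb.
Proof.
by move=> q p r /asboolP pq /asboolP qr; apply/asboolP; apply: span_sim_trans qr.
Qed.

Canonical span_equiv :=
  EquivRel span_simb span_simb_refl span_simb_sym span_simb_trans.

Definition Garrow : Type := {eq_quot span_equiv}.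

Definition cls (p : span) : Garrow := \pi_{eq_quot span_equiv} (p : {classic span}).

Definition rep (X : Garrow) : span := repr (X : {eq_quot span_equiv}).

Lemma repK X : cls (rep X) = X.
Proof. exact: reprK. Qed.

Lemma clsP p q : cls p = cls q <-> span_sim p q.
Proof.
split.
  by move/eqP; rewrite eqmodE => /asboolP.
by move=> h; apply/eqP; rewrite eqmodE; apply/asboolP.
Qed.

Lemma cls_surj X : exists p, X = cls p.
Proof. by exists (rep X); rewrite repK. Qed.

Definition diag (a : C) : span := @Span a a erefl.
Definition flip (p : span) : span := Span (esym (span_dom p)).

Definition Gdom (X : Garrow) : Garrow := cls (diag (leg2 (rep X))).
Definition Gran (X : Garrow) : Garrow := cls (diag (leg1 (rep X))).
Definition Ginv (X : Garrow) : Garrow := cls (flip (rep X)).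

(* [a,b] . [c,d] = [a,du] where b = cu with u an isomorphism; here
   p = (a,b), q = (c,d) and s = (a,du). *)
Definition Gpprod (X Y Z : Garrow) : Prop :=
  exists (p q s : span) (u : C),
    [/\ X = cls p, Y = cls q & Z = cls s] /\
    [/\ is_iso u, pprod (leg1 q) u (leg2 p),
        leg1 s = leg1 p & pprod (leg2 q) u (leg2 s)].

Definition Gle (X Y : Garrow) : Prop :=
  exists (p q : span) (r : C), [/\ X = cls p, Y = cls q & span_mul q r p].

Definition Gprecategory : precategory := Precategory Gdom Gran Gpprod.

Lemma rep_sim p : span_sim (rep (cls p)) p.
Proof. by apply/clsP; rewrite repK. Qed.

Lemma Gdom_cls p : Gdom (cls p) = cls (diag (leg2 p)).
Proof.
by have [u iu [_ h]] := rep_sim p; apply/clsP; exists u => //; split.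
Qed.

Lemma Gran_cls p : Gran (cls p) = cls (diag (leg1 p)).
Proof.
by have [u iu [h _]] := rep_sim p; apply/clsP; exists u => //; split.
Qed.

Lemma Ginv_cls p : Ginv (cls p) = cls (flip p).
Proof.
by have [u iu [h1 h2]] := rep_sim p; apply/clsP; exists u => //; split.
Qed.

Lemma Gle_cls p q : Gle (cls p) (cls q) <-> exists r, span_mul q r p.
Proof.
split; last by case=> r h; exists p, q, r.
case=> [p' [q' [r [/clsP [u _ pp'] /esym/clsP [v _ q'q] h]]]].
have [w _ hw] := span_mul_comp h q'q.
have [w' _ hw'] := span_mul_comp pp' hw.
by exists w'.
Qed.

Lemma span_mul_ex p u : dom (leg1 p) = ran u -> exists q, span_mul p u q.
Proof.
move=> h; have [a pa] := pprod_ex hC h.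
have [b pb] : exists b, pprod (leg2 p) u b.
  by apply: (pprod_ex hC); rewrite -span_dom.
have e : dom a = dom b by rewrite (dom_pprod hC pa) (dom_pprod hC pb).
by exists (Span e).
Qed.

Lemma Gpprod_intro p q s : leg2 p = leg1 q -> leg1 s = leg1 p ->
  leg2 s = leg2 q -> Gpprod (cls p) (cls q) (cls s).
Proof.
move=> pq sp sq; exists p, q, s, (dom (leg1 q)); split=> //; split=> //.
- exact: iso_identity hC _ (dom_id hC _).
- by rewrite pq; apply: pprod_dom hC _.
- by rewrite sq span_dom; apply: pprod_dom hC _.
Qed.

Lemma span_mul_fun p u q q' : span_mul p u q -> span_mul p u q' -> q = q'.
Proof.
move=> [h1 h2] [h1' h2']; apply: span_ext.
  exact: pprod_fun hC _ _ _ _ h1 h1'.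
exact: pprod_fun hC _ _ _ _ h2 h2'.
Qed.

(* Any representative of the left factor can be completed to representatives of
   the form [a,b] . [b,c] = [a,c]. *)
Lemma Gpprod_elim p Y Z : Gpprod (cls p) Y Z ->
  exists q s, [/\ Y = cls q, Z = cls s, leg1 q = leg2 p, leg1 s = leg1 p &
    leg2 s = leg2 q].
Proof.
case=> [p' [q' [s' [u [[/clsP [v iv [pp1 pp2]] -> ->] [iu q1 s1 q2]]]]]].
have [w uv h1] := pprodAl hC q1 pp2.
have [d q2w] : exists d, pprod (leg2 q') w d.
  by apply: (pprod_ex hC); rewrite -span_dom (pprod_eq hC h1).
have eq : dom (leg2 p) = dom d.
  by rewrite (dom_pprod hC h1) (dom_pprod hC q2w).
have es : dom (leg1 p) = dom d by rewrite span_dom.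
exists (Span eq), (Span es); split=> //.
- apply: esym; apply/clsP; exists w; first exact: iso_pprod hC _ _ _ iu iv uv.
  by split.
- apply: esym; apply/clsP; exists v => //; split=> /=; first by rewrite s1.
  by apply/(pprodA hC _ q2 uv).
Qed.

Lemma cls_leg1_inj p q : leg1 p = leg1 q -> cls p = cls q -> p = q.
Proof.
move=> e /clsP [u iu [h1 h2]]; apply: span_ext => //.
have hu : u = dom (leg1 q).
  apply: (@lC (leg1 q) u _ (leg1 q)); first by rewrite -{2}e.
  exact: pprod_dom hC _.
move: h2; rewrite hu span_dom => h2.
exact: pprod_fun hC _ _ _ _ h2 (pprod_dom hC _).
Qed.

Lemma G_is_category : is_category Gprecategory.
Proof.
have gid a : is_identity (cls (diag a) : Gprecategory).
  split=> X Z /=.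
    case/Gpprod_elim=> [q [s [-> -> e1 e2 e3]]].
    by congr cls; apply: span_ext; rewrite // e2 e1.
  case: (cls_surj X) => p -> /Gpprod_elim [q [s [eq -> e1 e2 e3]]].
  case/clsP: (esym eq) => u _ [/= h1 h2].
  congr cls; apply: span_ext; rewrite // e3 -e1.
  exact: pprod_fun hC _ _ _ _ h2 h1.
split=> /=.
- move=> X Y Z Z'; case: (cls_surj X) => p ->.
  move=> /Gpprod_elim [q [s [-> -> e1 e2 e3]]].
  move=> /Gpprod_elim [q' [s' [eq -> e1' e2' e3']]].
  have eqq : q = q' by apply: cls_leg1_inj => //; rewrite e1 e1'.
  rewrite -eqq in e3'.
  by congr cls; apply: span_ext; rewrite ?e2 ?e2' ?e3 ?e3'.
- move=> X Y; case: (cls_surj X) => p ->; split.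
    case=> Z /Gpprod_elim [q [s [-> _ e1 _ _]]].
    by rewrite Gdom_cls Gran_cls e1.
  case: (cls_surj Y) => q ->; rewrite Gdom_cls Gran_cls => /clsP [u iu [h _]].
  have [t qt] : exists t, span_mul q u t.
    by apply: span_mul_ex; rewrite (pprod_eq hC h).
  have e : leg2 p = leg1 t by exact: pprod_fun hC _ _ _ _ h qt.1.
  have es : dom (leg1 p) = dom (leg2 t) by rewrite span_dom e span_dom.
  have -> : cls q = cls t by apply: esym; apply/clsP; exists u.
  by exists (cls (Span es)); apply: Gpprod_intro.
- by move=> X; apply: gid.
- by move=> X; apply: gid.
- move=> X; case: (cls_surj X) => p ->; rewrite Gdom_cls.
  exact: Gpprod_intro.
- move=> X; case: (cls_surj X) => p ->; rewrite Gran_cls.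
  exact: Gpprod_intro.
- move=> X Y Z; case: (cls_surj X) => p -> /Gpprod_elim.
  by case=> q [s [-> -> _ _ e]]; rewrite !Gdom_cls e.
- move=> X Y Z; case: (cls_surj X) => p -> /Gpprod_elim.
  by case=> q [s [_ -> _ e _]]; rewrite !Gran_cls e.
- move=> X Y Z U V W; case: (cls_surj X) => p ->.
  move=> /Gpprod_elim [q [s [-> -> e1 e2 e3]]].
  move=> /Gpprod_elim [q' [s' [-> -> e1' e2' e3']]]; split.
    move=> /Gpprod_elim [q2 [s2 [eq -> e1'' e2'' e3'']]].
    have eqq : q' = q2 by apply: cls_leg1_inj; rewrite // e1' e1'' e3.
    by apply: Gpprod_intro; rewrite ?e2' ?e1 ?e2'' ?e2 // e3'' e3' eqq.
  move=> /Gpprod_elim [q2 [s2 [eq -> e1'' e2'' e3'']]].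
  have eqq : s' = q2 by apply: cls_leg1_inj; rewrite // e2' e1 e1''.
  by apply: Gpprod_intro; rewrite ?e2 ?e2'' // ?e3 ?e1' // e3'' -eqq.
Qed.

Lemma Gpprod_inv (X : Gprecategory) : Gpprod X (Ginv X) (Gran X).
Proof.
by case: (cls_surj X) => p ->; rewrite Ginv_cls Gran_cls; apply: Gpprod_intro.
Qed.

Lemma Gpprod_invl (X : Gprecategory) : Gpprod (Ginv X) X (Gdom X).
Proof.
by case: (cls_surj X) => p ->; rewrite Ginv_cls Gdom_cls; apply: Gpprod_intro.
Qed.

Lemma Gle_order : Relation_Definitions.order Garrow Gle.
Proof.
split.
- move=> X; case: (cls_surj X) => p ->; apply/Gle_cls.
  by have [u _ h] := span_sim_refl p; exists u.
- move=> X Y Z; case: (cls_surj X) => p ->; case: (cls_surj Y) => q ->.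
  case: (cls_surj Z) => r -> /Gle_cls [u hu] /Gle_cls [v hv]; apply/Gle_cls.
  by have [w _ hw] := span_mul_comp hu hv; exists w.
- move=> X Y; case: (cls_surj X) => p ->; case: (cls_surj Y) => q ->.
  move=> /Gle_cls [u hu] /Gle_cls [v hv]; apply/clsP; exists u => //.
  have [w vu hw] := span_mul_comp hu hv.
  have [w' uv hw'] := span_mul_comp hv hu.
  exists v; split.
    have -> // : ran u = w'.
    apply: lC (hw'.1).
    by rewrite -(pprod_eq hC hu.1); apply: pprod_dom hC _.
  have -> // : dom u = w.
  apply: lC (hw.1).
  by rewrite -(dom_pprod hC hu.1); apply: pprod_dom hC _.
Qed.

Lemma Gle_inv (X Y : Gprecategory) : Gle X Y -> Gle (Ginv X) (Ginv Y).
Proof.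
case: (cls_surj X) => p ->; case: (cls_surj Y) => q ->.
by rewrite !Ginv_cls => /Gle_cls [r [h1 h2]]; apply/Gle_cls; exists r; split.
Qed.

Lemma Gle_pprod (X Y U V S T : Gprecategory) :
  Gle X Y -> Gle U V -> Gpprod X U S -> Gpprod Y V T -> Gle S T.
Proof.
case: (cls_surj X) => p ->; case: (cls_surj Y) => q -> /Gle_cls [r [h1 h2]] UV.
move=> /Gpprod_elim [p' [s [eU -> e1 e2 e3]]].
move=> /Gpprod_elim [q' [t [eV -> f1 f2 f3]]].
move: UV; rewrite eU eV => /Gle_cls [r' [h1' h2']].
apply/Gle_cls; exists r; split; first by rewrite e2 f2.
rewrite e3 f3; have -> // : r = r'.
by apply: lC h2 _; rewrite -f1 -e1.
Qed.

Lemma Gidentity (e : Gprecategory) :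
  is_identity e -> exists a, e = cls (diag a).
Proof.
move=> /(dom_identity G_is_category) <-.
by exists (leg2 (rep e)).
Qed.

Lemma G_restriction (X e : Gprecategory) : is_identity e -> Gle e (Gdom X) ->
  exists! X', Gle X' X /\ Gdom X' = e.
Proof.
move=> /Gidentity [f ->]; case: (cls_surj X) => p ->.
rewrite Gdom_cls => /Gle_cls [r [/= hr _]].
have [q hq] : exists q, span_mul p r q.
  by apply: span_mul_ex; rewrite span_dom (pprod_eq hC hr).
have fq : f = leg2 q by exact: pprod_fun hC _ _ _ _ hr hq.2.
exists (cls q); split; first by split; [apply/Gle_cls; exists r | rewrite Gdom_cls fq].
move=> X' []; case: (cls_surj X') => t -> /Gle_cls [r' ht].
rewrite Gdom_cls => /clsP [u iu [/= h _]].
apply: esym; apply/clsP; exists u => //.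
rewrite fq in h; split=> //.
have [w ru hw] := pprodAl hC hq.2 h.
have wr : w = r' by apply: lC hw ht.2.
by apply/(pprodA hC _ hq.1 ru); rewrite wr; apply: ht.1.
Qed.

Lemma Gflip X : Ginv (Ginv X) = X.
Proof.
by case: (cls_surj X) => p ->; rewrite !Ginv_cls; congr cls; apply: span_ext.
Qed.

Lemma Gdom_inv X : Gdom (Ginv X) = Gran X.
Proof. by case: (cls_surj X) => p ->; rewrite Ginv_cls Gdom_cls Gran_cls. Qed.

Lemma G_corestriction (X e : Gprecategory) : is_identity e -> Gle e (Gran X) ->
  exists! X', Gle X' X /\ Gran X' = e.
Proof.
move=> ie; rewrite -Gdom_inv => /(G_restriction ie) [Y [[YX dY] uY]].
exists (Ginv Y); split.
  by split; [rewrite -(Gflip X); apply: Gle_inv | rewrite -Gdom_inv Gflip].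
move=> Z [ZX rZ]; rewrite (uY (Ginv Z)) ?Gflip //.
by split; [apply: Gle_inv | rewrite Gdom_inv].
Qed.

Definition G_of : ordered_groupoid :=
  @OrderedGroupoid Gprecategory Ginv Gle G_is_category Gpprod_inv Gpprod_invl
    Gle_order Gle_inv Gle_pprod G_restriction G_corestriction.

End GroupoidOfCategory.

Section CategoryOfGroupoid.
Variable G : ordered_groupoid.

Definition Lmem (e x : G) : Prop := is_identity e /\ og_le (ran x) e.

Definition Larrow : Type := {p : G * G | Lmem p.1 p.2}.

Definition Lpair (e x : G) (h : Lmem e x) : Larrow := exist _ (e, x) h.

Lemma Lmem_identity (e : G) : is_identity e -> Lmem e e.
Proof.
move=> ie; split=> //; rewrite (ran_identity (og_is_category G) ie).
exact: Relation_Definitions.ord_refl _ _ (og_order G) e.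
Qed.

Definition Ldom (s : Larrow) : Larrow :=
  Lpair (Lmem_identity (dom_id (og_is_category G) (sval s).2)).

Definition Lran (s : Larrow) : Larrow :=
  Lpair (Lmem_identity (proj1 (svalP s))).

Definition Lpprod (s t w : Larrow) : Prop :=
  [/\ dom (sval s).2 = (sval t).1, (sval w).1 = (sval s).1 &
      pseudoproduct (sval s).2 (sval t).2 (sval w).2].

Definition L_of : precategory := Precategory Ldom Lran Lpprod.

End CategoryOfGroupoid.

Section Embedding.
Variable C : lc_category.

Let hC : is_category C := lc_is_category C.

Definition span_to_dom (a : C) : span C := Span (esym (domK hC a)).

Lemma iotaC_mem (a : C) :
  @Lmem (G_of C) (cls (diag (ran a))) (cls (span_to_dom a)).
Proof.
split.
  have := ran_id (G_is_category C) (cls (diag (ran a))).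
  by rewrite /= Gran_cls.
rewrite /= Gran_cls; apply/Gle_cls; exists a; split; exact: pprod_ran hC a.
Qed.

Definition iotaC (a : C) : L_of (G_of C) := Lpair (iotaC_mem a).

End Embedding.

(* Main.v *)
(* In L(G) the meet in the pseudoproduct x (x) y is just r(y), so composition is
   (e,x)(f,y) = (e, (x | r(y)) y); associativity and left cancellation of L(G)
   come down to uniqueness of restrictions.  An arrow (E,X) of L(G(C)) lies in
   the image of iota as soon as E = [g,g] and d(X) = [f,f] with f, g identities,
   since then X = [c,f] for some c with r(c) = g; this gives fullness.
   Density follows because (r(X), X) is always an isomorphism of L(G), applied
   to X = [d(a),a].  A full, isomorphism-dense, injective functor into a left
   cancellative category is an equivalence. *)

Require Import Defs.
From mathcomp Require Import all_boot.
From mathcomp Require Import boolp classical_sets.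

Set Implicit Arguments.
Unset Strict Implicit.
Unset Printing Implicit Defensive.

Local Open Scope classical_set_scope.

(** * Injective functors with full, isomorphism-dense range *)

Section FullFaithfulDense.
Variables (C D : precategory) (F : C -> D).
Hypotheses (hC : is_category C) (hD : is_category D).
Hypotheses (lD : left_cancellative D) (hF : is_functor F) (iF : injective F).
Hypothesis fF : full (range F).

Lemma functor_identity e : is_identity e -> is_identity (F e).
Proof.
move=> ie; rewrite -(dom_identity hC ie) (functor_dom hF); exact: dom_id hD _.
Qed.

(** Injectivity turns d(F x) = r(F y) into d(x) = r(y), so the product already exists in [C]. *)
Lemma functor_reflects_pprod x y (d : D) : pprod (F x) (F y) d ->
  exists2 z, pprod x y z & F z = d.
Proof.
move=> h; have [z xyz] : exists z, pprod x y z.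
  apply: (pprod_ex hC); apply: iF.
  by rewrite (functor_dom hF) (functor_ran hF) (pprod_eq hD h).
by exists z => //; apply: (pprod_fun hD (functor_pprod hF xyz) h).
Qed.

Lemma range_subcategory : is_subcategory (range F).
Proof.
split=> [_ [x _ <-]|_ [x _ <-]|_ _ z [x _ <-] [y _ <-]].
- by exists (dom x); rewrite ?(functor_dom hF).
- by exists (ran x); rewrite ?(functor_ran hF).
- by case/functor_reflects_pprod => c _ <-; exists c.
Qed.

(** Fullness places the inverse of [F x] in the range of [F]; its preimage inverts [x]. *)
Lemma full_functor_reflects_iso x : is_iso (F x) -> is_iso x.
Proof.
case=> v [Fxv vFx].
have [y _ yv] : range F v.
  apply: fF.
    exists (ran x) => //.
    by rewrite (functor_ran hF) -(dom_pprod hD Fxv) (dom_ran hD).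
  exists (dom x) => //.
  by rewrite (functor_dom hF) -(ran_pprod hD vFx) (ran_dom hD).
exists y; rewrite -yv in Fxv vFx; split.
  have [z xyz zE] := functor_reflects_pprod Fxv.
  by rewrite -(iF (etrans zE (esym (functor_ran hF x)))).
have [z xyz zE] := functor_reflects_pprod vFx.
by rewrite -(iF (etrans zE (esym (functor_dom hF x)))).
Qed.

Lemma equivalent_of_full_dense : iso_dense (range F) -> equivalent C D.
Proof.
move=> dF.
have /choice [T hT] : forall e, exists u, is_identity e ->
    [/\ is_iso u, range F (dom u) & ran u = e].
  (* Off the identities [T] takes an arbitrary default value; at an identity it is the inverse of
     the isomorphism given by density. *)
  move=> e; have [ie|nie] := pselect (is_identity e); last by exists e.
  have [f [Ff _ [u [[v [uv vu]] du ru]]]] := dF e ie.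
  have rv : ran v = dom u by rewrite (pprod_eq hD uv).
  have dv : dom v = ran u by rewrite (pprod_eq hD vu).
  exists v => _; split; [|by rewrite dv ru|by rewrite rv du].
  by exists u; rewrite rv dv.
(* [K x] is the preimage under [F] of the conjugate T(r(x))^{-1} x T(d(x)), which makes [T] natural
   by construction. *)
have /choice [K hK] : forall x, exists c, exists z,
    pprod (T (ran x)) (F c) z /\ pprod x (T (dom x)) z.
  move=> x.
  have [_ Fd rd] := hT _ (dom_id hD x).
  have [[v [Tv vT]] Fr rr] := hT _ (ran_id hD x).
  have [z xz] := pprod_ex hD (esym rd).
  have [y vz] : exists y, pprod v z y.
    apply: (pprod_ex hD); rewrite (pprod_eq hD vT) rr.
    by rewrite (ran_pprod hD xz).
  have [c _ cy] : range F y.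
    apply: fF; first by rewrite (dom_pprod hD vz) (dom_pprod hD xz).
    by rewrite (ran_pprod hD vz) -(pprod_eq hD Tv).
  exists c, z; rewrite cy; split=> //; apply/(pprodA hD z Tv vz).
  by rewrite rr -(ran_pprod hD xz); apply: pprod_ran hD _.
have domFK x : F (dom (K x)) = dom (T (dom x)).
  have [z [h1 h2]] := hK x.
  by rewrite (functor_dom hF) -(dom_pprod hD h1) (dom_pprod hD h2).
have ranFK x : F (ran (K x)) = dom (T (ran x)).
  by have [z [h1 _]] := hK x; rewrite (functor_ran hF) (pprod_eq hD h1).
(* At an identity the square reads T(e) F(K e) = T(e), and cancelling T(e) leaves its domain. *)
have FK_id e : is_identity e -> F (K e) = dom (T e).
  move=> ie; have [z [h1 h2]] := hK e.
  move: h1 h2; rewrite (ran_identity hD ie) (dom_identity hD ie) => h1 h2.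
  rewrite (ie.1 _ _ h2) in h1; exact: lD h1 (pprod_dom hD _).
exists F, K; split=> //.
- split=> [x|x|x y z xyz]; try apply: iF.
  + by rewrite domFK FK_id //; apply: dom_id hD _.
  + by rewrite ranFK FK_id //; apply: ran_id hD _.
  have [a [ax xa]] := hK x; have [b [yb by_]] := hK y.
  have [c [zc cz]] := hK z.
  have xy := pprod_eq hD xyz.
  have [m KK] : exists m, pprod (F (K x)) (F (K y)) m.
    apply: (pprod_ex hD).
    by rewrite -(functor_dom hF) -(functor_ran hF) domFK ranFK xy.
  have [w KKw wm] := functor_reflects_pprod KK.
  suff -> : K z = w by [].
  (* Multiplied on the left by T(r(z)), both F(K z) and F(K x) F(K y) give z T(d(z)). *)
  apply: iF; rewrite wm; apply: lD zc _.
  rewrite (ran_pprod hD xyz); apply/(pprodA hD c ax KK).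
  rewrite -xy in yb.
  apply/(pprodA hD c xa yb); apply/(pprodA hD c xyz by_).
  by rewrite -(dom_pprod hD xyz).
(* [T (F e)] starts in the range of [F] and ends at [F e], so fullness lifts it to an arrow [s e] of
   [C]. *)
- have /choice [s hs] : forall e, exists c, is_identity e -> F c = T (F e).
    move=> e; have [ie|nie] := pselect (is_identity e); last by exists e.
    have [_ h1 h2] := hT _ (functor_identity ie).
    by have [c _ <-] := fF h1 (ex_intro2 _ _ e I (esym h2)); exists c.
  exists s; split=> [e ie|x].
    have [i1 h1 h2] := hT _ (functor_identity ie).
    split; first by apply: full_functor_reflects_iso; rewrite hs.
      apply: iF; rewrite (functor_dom hF) hs //=.
      by rewrite FK_id //; apply: functor_identity.
    by apply: iF; rewrite (functor_ran hF) hs.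
  have [z [h1 h2]] := hK (F x).
  rewrite -(functor_ran hF) -hs in h1; last exact: ran_id hC _.
  rewrite -(functor_dom hF) -hs in h2; last exact: dom_id hC _.
  have [c h1' cz] := functor_reflects_pprod h1.
  have [d h2' dz] := functor_reflects_pprod h2.
  by exists c; split=> //=; rewrite (iF (etrans cz (esym dz))).
- exists T; split=> [e ie|x]; last exact: hK.
  by have [i1 h1 h2] := hT _ ie; split=> //=; rewrite FK_id.
Qed.

End FullFaithfulDense.

(** * Order, restrictions and pseudoproducts in an ordered groupoid *)

Section OrderedGroupoidTheory.
Variable G : ordered_groupoid.
Implicit Types e x y z : G.

Let hG : is_category G := og_is_category G.

Lemma og_le_refl x : og_le x x.
Proof. exact: Relation_Definitions.ord_refl (og_order G) x. Qed.

Lemma og_le_trans x y z : og_le x y -> og_le y z -> og_le x z.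
Proof. exact: Relation_Definitions.ord_trans (og_order G) x y z. Qed.

Lemma og_le_anti x y : og_le x y -> og_le y x -> x = y.
Proof. exact: Relation_Definitions.ord_antisym (og_order G) x y. Qed.

(** r(x) = x x^{-1}, and both inversion and product are monotone. *)
Lemma og_le_ran x y : og_le x y -> og_le (ran x) (ran y).
Proof. move=> xy; exact: (og_leM xy (og_leV xy) (og_pprodV x) (og_pprodV y)). Qed.

Lemma og_le_dom x y : og_le x y -> og_le (dom x) (dom y).
Proof. move=> xy; exact: (og_leM (og_leV xy) xy (og_pprodVl x) (og_pprodVl y)). Qed.

Lemma restriction_uniq x y z :
  og_le y x -> og_le z x -> dom y = dom z -> y = z.
Proof.
move=> yx zx yz.
have [w [_ wu]] := og_restriction (dom_id hG y) (og_le_dom yx).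
by rewrite -(wu y) // -(wu z).
Qed.

Lemma corestriction_uniq x y z :
  og_le y x -> og_le z x -> ran y = ran z -> y = z.
Proof.
move=> yx zx yz.
have [w [_ wu]] := og_corestriction (ran_id hG y) (og_le_ran yx).
by rewrite -(wu y) // -(wu z).
Qed.

Lemma restriction_ex x e : is_identity e -> og_le e (dom x) ->
  exists2 y, og_le y x & dom y = e.
Proof. by move=> ie /(og_restriction ie) [y [[yx ye] _]]; exists y. Qed.

(** Both [x] and d(x) lie below [e] with the same domain, so uniqueness of restrictions identifies
    them. *)
Lemma og_le_identity x e : is_identity e -> og_le x e -> x = dom x.
Proof.
move=> ie xe; apply: (restriction_uniq xe); last by rewrite (domK hG).
by rewrite -(dom_identity hG ie); apply: og_le_dom.
Qed.

Lemma og_lcancel : left_cancellative G.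
Proof.
move=> x y z w xy xz.
have key t : pprod x t w -> pprod (og_inv x) w t.
  move=> xt; apply/(pprodA hG t (og_pprodVl x) xt).
  by rewrite (pprod_eq hG xt); apply: pprod_ran hG _.
exact: (pprod_fun hG (key _ xy) (key _ xz)).
Qed.

(** As r(y) is below d(x), it is itself the meet, and the corestriction of [y] to its own range is
    [y]. *)
Lemma pseudoproductE x y z : og_le (ran y) (dom x) ->
  pseudoproduct x y z <-> exists2 x', og_le x' x & pprod x' y z.
Proof.
move=> yx; split.
  case=> e [x' [y' [[ie e1 e2 e3] [x'x dx'] [y'y ry'] xyz]]].
  exists x' => //.
  have er : e = ran y.
    by apply: og_le_anti => //; apply: e3 => //;
      [apply: ran_id hG _ | apply: og_le_refl].
  have <- // : y' = y.
  by apply: (corestriction_uniq y'y (og_le_refl y)); rewrite ry'.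
case=> x' x'x xyz; exists (ran y), x', y; split=> //.
- by split=> //; [apply: ran_id hG _ | apply: og_le_refl].
- by split=> //; rewrite (pprod_eq hG xyz).
- by split=> //; apply: og_le_refl.
Qed.

(** * The left cancellative category L(G) *)

Lemma Larrow_ext (s t : L_of G) :
  (sval s).1 = (sval t).1 -> (sval s).2 = (sval t).2 -> s = t.
Proof.
case: s t => [[e x] h] [[f y] k] /= ef xy.
by apply: eq_exist; rewrite ef xy.
Qed.

Lemma LpprodE (s t w : L_of G) : pprod s t w <->
  [/\ dom (sval s).2 = (sval t).1, (sval w).1 = (sval s).1 &
      exists2 x', og_le x' (sval s).2 & pprod x' (sval t).2 (sval w).2].
Proof.
by split; case=> h1 h2 h3; split=> //; apply/pseudoproductE => //;
  rewrite h1; apply: (svalP t).2.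
Qed.

(** Restricting shrinks the range, so r(z) = r(x) stays below the first component of [s]. *)
Lemma Lpprod_of (s t : L_of G) x z : dom (sval s).2 = (sval t).1 ->
  og_le x (sval s).2 -> pprod x (sval t).2 z ->
  exists w : L_of G, [/\ pprod s t w, (sval w).1 = (sval s).1 & (sval w).2 = z].
Proof.
move=> st xs xz.
have h : Lmem (sval s).1 z.
  split; first exact: (svalP s).1.
  rewrite (ran_pprod hG xz).
  exact: (og_le_trans (og_le_ran xs) (svalP s).2).
by exists (Lpair h); split=> //; apply/LpprodE; split=> //; exists x.
Qed.

Lemma L_pprod_fun (s t w w' : L_of G) : pprod s t w -> pprod s t w' -> w = w'.
Proof.
move=> /LpprodE [_ w1 [x xs xw]] /LpprodE [_ w1' [x' xs' xw']].
apply: Larrow_ext; first by rewrite w1 w1'.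
have e : x = x'.
  by apply: (restriction_uniq xs xs'); rewrite (pprod_eq hG xw) (pprod_eq hG xw').
by rewrite -e in xw'; apply: (pprod_fun hG xw xw').
Qed.

Lemma L_identity e (h : Lmem e e) : is_identity (Lpair h : L_of G).
Proof.
have [ie _] := h; split=> t w /LpprodE [/= h1 h2 [x xs xw]].
  apply: Larrow_ext; first by rewrite h2 -h1 (dom_identity hG ie).
  rewrite (og_le_identity ie xs) in xw.
  exact: (dom_id hG x).1 xw.
apply: Larrow_ext => //.
(* Here [x] is the restriction to the whole domain. *)
have xt : x = (sval t).2.
  apply: (restriction_uniq xs (og_le_refl _)).
  by rewrite (pprod_eq hG xw) h1 (ran_identity hG ie).
by rewrite -xt; apply: ie.2 xw.
Qed.

Lemma L_is_category : is_category (L_of G).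
Proof.
split.
- exact: L_pprod_fun.
- move=> s t; split.
    by case=> w /LpprodE [h _ _]; apply: Larrow_ext.
  move/(congr1 (fun p : L_of G => (sval p).1)) => /= st.
  have [x xs dx] : exists2 x, og_le x (sval s).2 & dom x = ran (sval t).2.
    by apply: restriction_ex; [apply: ran_id hG _ | rewrite st; apply: (svalP t).2].
  have [z xz] := pprod_ex hG dx.
  by have [w [stw _ _]] := Lpprod_of st xs xz; exists w.
- by move=> s; apply: L_identity.
- by move=> s; apply: L_identity.
- move=> s; apply/LpprodE; split=> //.
  by exists (sval s).2; [apply: og_le_refl | apply: pprod_dom hG _].
- move=> s; apply/LpprodE; split=> //=.
    exact: (dom_identity hG (svalP s).1).
  by exists (ran (sval s).2); [apply: (svalP s).2 | apply: pprod_ran hG _].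
- move=> s t w /LpprodE [_ _ [x _ xw]].
  by apply: Larrow_ext; rewrite /= (dom_pprod hG xw).
- by move=> s t w /LpprodE [_ w1 _]; apply: Larrow_ext.
move=> s t r u v w st tr.
have /LpprodE [st1 u1 [x xs xt]] := st; have /LpprodE [tr1 v1 [y yt yr]] := tr.
(* both bracketings have second component (x' y) r, where x' y is the
   restriction to r(r) of the second component of st *)
have [x' x'x dx'] : exists2 x', og_le x' x & dom x' = ran y.
  apply: restriction_ex; first exact: ran_id hG _.
  by rewrite (pprod_eq hG xt); apply: og_le_ran.
have [p x'y] := pprod_ex hG dx'.
have pu : og_le p (sval u).2 := og_leM x'x yt x'y xt.
have [z pr] : exists z, pprod p (sval r).2 z.
  by apply: (pprod_ex hG); rewrite (dom_pprod hG x'y) (pprod_eq hG yr).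
have du : dom (sval u).2 = (sval r).1 by rewrite (dom_pprod hG xt).
have [w1 [ur e1 e2]] := Lpprod_of du pu pr.
have sv : pprod s v w1.
  apply/LpprodE; split; [by rewrite v1|by rewrite e1|].
  exists x'; first exact: (og_le_trans x'x xs).
  by rewrite e2; apply/(pprodA hG _ x'y yr).
by split=> h; [rewrite (L_pprod_fun h ur) | rewrite (L_pprod_fun h sv)].
Qed.

(** The restrictions used in the two products both have the range of the second component of [w],
    hence coincide; then the groupoid cancels. *)
Lemma L_left_cancellative : left_cancellative (L_of G).
Proof.
move=> s t t' w /LpprodE [st1 _ [x xs xt]] /LpprodE [st1' _ [x' xs' xt']].
apply: Larrow_ext; first by rewrite -st1 -st1'.
have e : x = x'.
  apply: (corestriction_uniq xs xs').
  by rewrite -(ran_pprod hG xt) (ran_pprod hG xt').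
by rewrite -e in xt'; apply: (og_lcancel xt xt').
Qed.

Lemma Lmem_ran x : Lmem (ran x) x.
Proof. by split; [apply: ran_id hG _ | apply: og_le_refl]. Qed.

(** The inverse of (r(x), x) is (d(x), x^{-1}). *)
Lemma Lpair_ran_iso x : is_iso (Lpair (Lmem_ran x) : L_of G).
Proof.
have rV : ran (og_inv x) = dom x := esym (pprod_eq hG (og_pprodV x)).
have dV : dom (og_inv x) = ran x := pprod_eq hG (og_pprodVl x).
exists (Lpair (Lmem_ran (og_inv x))); split; apply/LpprodE; split=> //=.
- by exists x; [apply: og_le_refl | apply: og_pprodV].
- by exists (og_inv x); [apply: og_le_refl | apply: og_pprodVl].
Qed.

End OrderedGroupoidTheory.

(** * The embedding of C in L(G(C)) *)

Section Iota.
Variable C : lc_category.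

Let hC : is_category C := lc_is_category C.

Lemma iotaC_functor : is_functor (@iotaC C).
Proof.
split=> [x|x|x y z xyz].
- apply: Larrow_ext => /=; rewrite Gdom_cls /= ?(ran_dom hC) //.
  by congr cls; apply: span_ext => //=; rewrite (domK hC).
- apply: Larrow_ext => /=; rewrite ?(ranK hC) //.
  by congr cls; apply: span_ext => //=; rewrite (dom_ran hC).
- have e : dom z = dom y := dom_pprod hC xyz.
  apply/LpprodE; split=> /=.
  + by rewrite Gdom_cls /= (pprod_eq hC xyz).
  + by rewrite (ran_pprod hC xyz).
  (* The class [z,y] is the restriction of [x,d(x)] to [y,y], since (z,y) = (xy, d(x)y). *)
  exists (cls (Span e)).
    apply/Gle_cls; exists y; split=> //=.
    by rewrite (pprod_eq hC xyz); apply: pprod_ran hC _.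
  by apply: Gpprod_intro => /=.
Qed.

(** From a = bu and d(a) = d(b)u it follows that u = d(a), hence a = b. *)
Lemma iotaC_inj : injective (@iotaC C).
Proof.
move=> a b /(congr1 (fun p : L_of (G_of C) => (sval p).2)) /clsP.
case=> u _ [/= bu dbu].
have e := (dom_id hC b).1 _ _ dbu; rewrite -e in bu.
exact: (dom_id hC a).2 bu.
Qed.

Lemma iotaC_rangeP (s : L_of (G_of C)) f g : is_identity f -> is_identity g ->
  (sval s).1 = cls (diag g) -> dom (sval s).2 = cls (diag f) ->
  range (@iotaC C) s.
Proof.
move=> hf hg; case: s => [[E X] h] /= e1; subst E.
have [p eX] := cls_surj X; subst X; have [_ /= XE] := h.
move: XE; rewrite Gran_cls Gdom_cls => XE /clsP [u /(iso_inverse hC) [v iv uv] [/= fu _]].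
(* Multiplying the representative [p] on the right by [v], the inverse of [u], turns it into
   (c,f). *)
have [c pv] : exists c, pprod (leg1 p) v c.
  apply: (pprod_ex hC); rewrite span_dom.
  by rewrite (pprod_eq hC (uv _ _ fu)).
have fv := uv _ _ fu.
have dc : dom c = f.
  by rewrite (dom_pprod hC pv) -(dom_pprod hC fv) (dom_identity hC hf).
have rc : ran c = g.
  (* Lying below [g,g] means that the first leg of [p] is g r, whose range is g. *)
  move: XE => /Gle_cls [r [/= gr _]].
  by rewrite (ran_pprod hC pv) (ran_pprod hC gr) (ran_identity hC hg).
exists c => //; apply: Larrow_ext => /=; first by rewrite rc.
by apply/clsP; exists v => //; split=> //=; rewrite dc.
Qed.

Lemma iotaC_full : full (range (@iotaC C)).
Proof.
move=> s [a _ ha] [b _ hb].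
have e1 := congr1 (fun p : L_of (G_of C) => (sval p).1) ha.
have e2 := congr1 (fun p : L_of (G_of C) => (sval p).1) hb.
exact: (@iotaC_rangeP s _ _ (ran_id hC a) (ran_id hC b) (esym e2) (esym e1)).
Qed.

Lemma iotaC_dense : iso_dense (range (@iotaC C)).
Proof.
move=> e ie; have hL := L_is_category (G_of C).
have [a ea] : exists a, (sval e).1 = cls (diag a) := Gidentity (svalP e).1.
set X : G_of C := cls (flip (span_to_dom a)).
exists (iotaC (dom a)); split=> //.
  rewrite (functor_dom iotaC_functor); exact: dom_id hL _.
exists (Lpair (Lmem_ran X)); split; first exact: Lpair_ran_iso.
(* An identity equals its own range, so the first component of [e] determines it. *)
- by apply: Larrow_ext; rewrite -(ran_identity hL ie) /= ea Gdom_cls.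
- by apply: Larrow_ext => /=; rewrite Gran_cls /= ?(ran_dom hC) //;
    congr cls; apply: span_ext; rewrite //= (domK hC).
Qed.

End Iota.

Theorem theorem3p7 (C : lc_category) :
  let C' := L_of (G_of C) in
  [/\ is_category C' /\ left_cancellative C',
      is_functor (@iotaC C),
      injective (@iotaC C),
      [/\ is_subcategory (range (@iotaC C)),
          full (range (@iotaC C)) &
          iso_dense (range (@iotaC C))] &
      equivalent C C'].
Proof.
have hC := lc_is_category C; have hL := L_is_category (G_of C).
have lL := @L_left_cancellative (G_of C).
have hF := iotaC_functor C; have iF := @iotaC_inj C.
move=> C'; split=> //.
  split; [exact: range_subcategory | exact: iotaC_full | exact: iotaC_dense].
exact: (equivalent_of_full_dense hC hL lL hF iF (@iotaC_full C) (@iotaC_dense C)).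
Qed.
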